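(* Let $\chi:U_1\to\mathbb{Z}/p^2\mathbb{Z}$ be a surjective continuous character of type $\langle l,m\rangle$. Then $\chi$ is strictly equivalent to a character whose standard expansion is $$x_l\,\mathfrak{Z}_l+\sum_{\substack{m-l\le j\le m\\ p\nmid j}} b_j\cdot p\,\mathfrak{Z}_j,$$ where $x_l,b_j\in\{0,1,\dots,p-1\}$, $x_l\neq 0$, and if $p\nmid m$ then $b_m\neq 0$. (A character of this form is called a reduced form of type $\langle l,m\rangle$.) In other words, every strict equivalence class of type $\langle l,m\rangle$ contains a reduced form.
   Context: Let $p$ be a prime, $K=\mathbb{F}_p((t))$, $U_1=1+t\mathbb{F}_p[[t]]$ the group of principal units, and $U_j=1+t^j\mathbb{F}_p[[t]]$ for $j\ge1$; $U_1$ carries the $t$-adic topology. The Nottingham group $\mathcal{N}$ over $\mathbb{F}_p$ is the set of power series $u(t)=t(1+c_1t+c_2t^2+\cdots)$ with $c_i\in\mathbb{F}_p$, a group under composition. A character is a continuous homomorphism $\chi:U_1\to\mathbb{Z}/p^2\mathbb{Z}$ (discrete topology on the target). $\mathcal{N}$ acts on characters by ${}_u\chi(f(t))=\chi(f(u(t)))$ for $f\in U_1$. Two characters $\chi,\psi$ are strictly equivalent, $\chi\simeq\psi$, if there is $u\in\mathcal{N}$ with $\psi={}_u\chi$ and $\chi(u(t)/t)=0$. A surjective character $\chi$ has type (break sequence) $\langle l,m\rangle$ where $l$ is the largest integer $b$ with $\chi(U_b)\not\subset p\mathbb{Z}/p^2\mathbb{Z}$ and $m$ is the largest integer $b$ with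 $\chi(U_b)\neq 0$. Put $E_j=1+t^j$. The elements $E_j$ with $p\nmid j$ form a topological $\mathbb{Z}_p$-basis of $U_1$; for $p\nmid j$, $\mathfrak{Z}_j$ denotes the character with $\mathfrak{Z}_j(E_i)=\delta_{ij}$ for all $i$ with $p\nmid i$. Every character of type $\langle l,m\rangle$ can be written uniquely in standard expansion $\chi=\sum_{1\le i\le l,\,p\nmid i}x_i\mathfrak{Z}_i+\sum_{1\le j\le m,\,p\nmid j}a_j\cdot p\,\mathfrak{Z}_j$ with $x_i,a_j\in\{0,\dots,p-1\}$; here $x_l\ne0$, and $a_m\neq0$ if $p\nmid m$. *)

(* Defs.v *)
From HB Require Import structures.
From mathcomp Require Import all_boot all_order all_algebra.
Set Implicit Arguments. Unset Strict Implicit. Unset Printing Implicit Defensive.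
Import GRing.Theory.
Local Open Scope ring_scope.

(* Formal power series over F_p, represented by their coefficient sequences:
   s n is the coefficient of t^n. *)
Definition ps (p : nat) := nat -> 'F_p.

Definition ps_one (p : nat) : ps p := fun n => (n == 0%N)%:R.

Definition ps_mul (p : nat) (a b : ps p) : ps p :=
  fun n => \sum_(i < n.+1) a i * b (n - i)%N.

Definition ps_pow (p : nat) (a : ps p) (k : nat) : ps p := iter k (ps_mul a) (ps_one p).

(* composition f(u(t)), for u with zero constant term *)
Definition ps_comp (p : nat) (f u : ps p) : ps p :=
  fun n => \sum_(k < n.+1) f k * ps_pow u k n.

Definition ps_divt (p : nat) (u : ps p) : ps p := fun n => u n.+1.

Definition inU (p : nat) (j : nat) (f : ps p) : Prop :=
  f 0%N = 1 /\ forall k, (0 < k < j)%N -> f k = 0.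

Definition inU1 (p : nat) (f : ps p) : Prop := inU 1 f.

Definition E (p : nat) (j : nat) : ps p :=
  fun n => if n == 0%N then 1 else if n == j then 1 else 0.

Definition nottingham (p : nat) (u : ps p) : Prop := u 0%N = 0 /\ u 1%N = 1.

(* A character U_1 -> Z/p^2Z: a continuous homomorphism (continuity w.r.t.
   the t-adic topology on U_1 and the discrete topology on Z/p^2Z, i.e.
   local constancy).  Only its values on U_1 matter. *)
Definition is_character (p : nat) (chi : ps p -> 'Z_(p ^ 2)) : Prop :=
  (forall f g, inU1 f -> inU1 g -> chi (ps_mul f g) = chi f + chi g) /\
  (forall f, inU1 f -> exists n : nat, forall g, inU1 g ->
       (forall k, (k < n)%N -> g k = f k) -> chi g = chi f).

Definition surjective_char (p : nat) (chi : ps p -> 'Z_(p ^ 2)) : Prop :=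
  forall z : 'Z_(p ^ 2), exists f, inU1 f /\ chi f = z.

Definition not_in_pZ (p : nat) (chi : ps p -> 'Z_(p ^ 2)) (b : nat) : Prop :=
  exists f, inU b f /\ ~~ (p %| (chi f : nat))%N.

Definition not_zero_on (p : nat) (chi : ps p -> 'Z_(p ^ 2)) (b : nat) : Prop :=
  exists f, inU b f /\ chi f != 0.

Definition has_type (p : nat) (chi : ps p -> 'Z_(p ^ 2)) (l m : nat) : Prop :=
  (1 <= l)%N /\ not_in_pZ chi l /\ (forall b, (1 <= b)%N -> not_in_pZ chi b -> (b <= l)%N) /\
  (1 <= m)%N /\ not_zero_on chi m /\ (forall b, (1 <= b)%N -> not_zero_on chi b -> (b <= m)%N).

Definition strictly_equiv (p : nat) (chi psi : ps p -> 'Z_(p ^ 2)) : Prop :=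
  exists u : ps p, nottingham u /\
    (forall f, inU1 f -> psi f = chi (ps_comp f u)) /\
    chi (ps_divt u) = 0.

(* psi has standard expansion  x_l Z_l + sum_{m-l<=j<=m, p∤j} b_j p Z_j
   with x_l in {1..p-1}, b_j in {0..p-1}, b_m <> 0 if p ∤ m.
   Equality of characters with this expansion is expressed by the values on
   the topological basis E_i (p ∤ i), where Z_j(E_i) = delta_ij. *)
Definition reduced_form (p : nat) (l m : nat) (psi : ps p -> 'Z_(p ^ 2)) : Prop :=
  exists (x : nat) (b : nat -> nat),
    (0 < x < p)%N /\ (forall j, (b j < p)%N) /\
    (~~ (p %| m)%N -> b m != 0%N) /\
    forall i, (1 <= i)%N -> ~~ (p %| i)%N ->
      psi (E p i) = ((x * (i == l) + p * b i * ((m - l <= i) && (i <= m)))%N)%:R.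

(* Main.v *)
(** The substitution u = t (1 + c t^(n-i) + ...) fixes E_j modulo t^(n+1) for
    j > i and multiplies E_i by 1 + i c t^n modulo t^(n+1).  If a character
    theta vanishes on U_(n+1) but not on U_n, then theta(E_i) can therefore be
    shifted by any multiple of theta(E_n) without changing theta(E_j) for j > i.
    With theta = p chi and n = l this kills chi(E_i) modulo p for i < l; with
    theta = chi and n = m it then adjusts chi(E_i) by multiples of p for
    i < m - l, where n - i > l guarantees that chi modulo p is not disturbed.
    In each step u/t is multiplied by a power of E_n, invisible to the above,
    to achieve chi(u/t) = 0. *)
Require Import Defs.
From mathcomp Require Import all_boot all_order all_algebra.
From mathcomp Require Import zify.

Set Implicit Arguments. Unset Strict Implicit. Unset Printing Implicit Defensive.
Import GRing.Theory.
Local Open Scope ring_scope.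

(** * Power series computed through polynomial truncations *)

Section PowerSeries.
Variable p : nat.
Implicit Types (f g h u v : ps p) (P Q : {poly 'F_p}).

(** Truncation transfers identities from [{poly 'F_p}] to power series. Only coefficients below [N]
    are compared, so [P] may have any degree. *)
Definition approx (N : nat) f P := forall k, (k < N)%N -> f k = P`_k.

Lemma approx_poly N f : approx N f (\poly_(i < N) f i).
Proof. by move=> k kN; rewrite coef_poly kN. Qed.

Lemma approx_one N : approx N (ps_one p) 1.
Proof. by move=> k _; rewrite coef1. Qed.

Lemma approx_mul N f g P Q :
  approx N f P -> approx N g Q -> approx N (ps_mul f g) (P * Q).
Proof.
move=> fP gQ k kN; rewrite coefM; apply: eq_bigr => i _.
by rewrite fP ?gQ //; have := ltn_ord i; lia.
Qed.

Lemma approx_pow N f P j : approx N f P -> approx N (ps_pow f j) (P ^+ j).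
Proof.
move=> fP; elim: j => [|j IH]; first exact: approx_one.
by rewrite exprS; apply: approx_mul.
Qed.

Lemma coef_exp_small Q i n : Q`_0 = 0 -> (n < i)%N -> (Q ^+ i)`_n = 0.
Proof.
move=> Q0; elim: i n => // i IH n ni; rewrite exprS coefM big1 // => -[j /= jn] _.
case: j jn => [|j] jn; first by rewrite Q0 mul0r.
by rewrite IH ?mulr0 //; lia.
Qed.

Lemma approx_comp N f u P Q : u 0%N = 0 ->
  approx N f P -> approx N u Q -> approx N (ps_comp f u) (P \Po Q).
Proof.
move=> u0 fP uQ n nN; have Q0 : Q`_0 = 0 by rewrite -uQ //; lia.
rewrite coef_comp_poly /ps_comp.
transitivity (\sum_(i < n.+1) P`_i * (Q ^+ i)`_n).
  apply: eq_bigr => i _; rewrite fP; last by have := ltn_ord i; lia.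
  by rewrite (approx_pow (P := Q) _ uQ).
(* The two sums stop at n+1 and at the size of [P]. Both equal the sum up to the maximum, since the
   extra terms vanish. *)
set F := fun i : nat => P`_i * (Q ^+ i)`_n.
rewrite -(big_mkord xpredT F) -[RHS](big_mkord xpredT F).
have tail a b : (forall i, (a <= i)%N -> F i = 0) -> (a <= b)%N ->
    \sum_(0 <= i < b) F i = \sum_(0 <= i < a) F i.
  move=> F0 ab; rewrite (big_cat_nat (n := a)) //= [X in _ + X]big_nat_cond.
  by rewrite [X in _ + X]big1 ?addr0 // => i /andP[/andP[/F0]].
rewrite -(@tail _ (maxn n.+1 (size P))) ?leq_maxl //; last first.
  by move=> i ni; rewrite /F coef_exp_small ?mulr0.
by apply: tail; rewrite ?leq_maxr // => i Pi; rewrite /F nth_default ?mul0r.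
Qed.

Lemma comp_psM f g u : u 0%N = 0 ->
  ps_comp (ps_mul f g) u =1 ps_mul (ps_comp f u) (ps_comp g u).
Proof.
move=> u0 n; have a h := @approx_poly n.+1 h.
rewrite (approx_comp u0 (approx_mul (a f) (a g)) (a u)) // comp_polyM.
by rewrite (approx_mul (approx_comp u0 (a f) (a u)) (approx_comp u0 (a g) (a u))).
Qed.

Lemma ps_comp0 f u : ps_comp f u 0%N = f 0%N.
Proof. by rewrite /ps_comp big_ord1 /= mulr1. Qed.

Lemma comp_psA f v u : u 0%N = 0 -> v 0%N = 0 ->
  ps_comp (ps_comp f v) u =1 ps_comp f (ps_comp v u).
Proof.
move=> u0 v0 n; have a h := @approx_poly n.+1 h.
have vu0 : ps_comp v u 0%N = 0 by rewrite ps_comp0.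
rewrite (approx_comp u0 (approx_comp v0 (a f) (a v)) (a u)) //.
by rewrite (approx_comp vu0 (a f) (approx_comp u0 (a v) (a u))) // comp_polyA.
Qed.

(** Multiplication by t: the elements of the Nottingham group are the series t v with v in U_1. *)
Definition ps_mult v : ps p := fun n => if n is n'.+1 then v n' else 0.

Lemma approx_mult N v P : approx N v P -> approx N.+1 (ps_mult v) ('X * P).
Proof. by move=> vP [|k] kN; rewrite coefXM //= vP. Qed.

Lemma ps_multK u : u 0%N = 0 -> ps_mult (ps_divt u) =1 u.
Proof. by move=> u0 [|n]. Qed.

Lemma approx_ext N f g P : f =1 g -> approx N f P -> approx N g P.
Proof. by move=> fg fP k /fP; rewrite fg. Qed.

(** The cocycle rule for u/t, thanks to which the condition chi(u/t) = 0 survives composition. *)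
Lemma divt_comp v u : u 0%N = 0 -> v 0%N = 0 ->
  ps_divt (ps_comp v u) =1 ps_mul (ps_comp (ps_divt v) u) (ps_divt u).
Proof.
move=> u0 v0 n; have a h := @approx_poly n.+1 h.
have au := approx_ext (ps_multK u0) (approx_mult (a (ps_divt u))).
have av := approx_ext (ps_multK v0) (approx_mult (a (ps_divt v))).
(* The left side reads coefficient n+1, where [au] and [av] still hold. The product on the right is
   computed modulo t^(n+1), hence this weaker copy. *)
have au' : approx n.+1 u ('X * \poly_(i < n.+1) ps_divt u i).
  by move=> k kn; rewrite au //; lia.
rewrite (approx_mul (approx_comp u0 (a _) au') (a (ps_divt u))) //.
rewrite /ps_divt (approx_comp u0 av au) // comp_polyM comp_polyX.
by rewrite -mulrA coefXM /= mulrC.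
Qed.

Lemma ps_pow_mult v j n :
  ps_pow (ps_mult v) j n = if (n < j)%N then 0 else ps_pow v j (n - j)%N.
Proof.
have a := @approx_poly n.+1 v.
have am : approx n.+1 (ps_mult v) ('X * \poly_(i < n.+1) v i).
  by move=> k kn; rewrite (approx_mult a) //; lia.
rewrite (approx_pow j am) // exprMn coefXnM; case: ifP => // _.
by rewrite (approx_pow j a) //; lia.
Qed.

(** * The filtration by the groups U_j *)

Lemma inU_le i j f : (i <= j)%N -> inU j f -> inU i f.
Proof. by move=> ij [f0 fj]; split=> // k kj; apply: fj; lia. Qed.

Lemma inU_1 j f : inU j f -> inU1 f.
Proof. by case=> f0 _; split=> // k; lia. Qed.

Lemma inU_one j : inU j (ps_one p).
Proof. by split=> // -[|k]. Qed.

Lemma inU_E j : inU j (E p j).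
Proof. by split=> // -[|k] // kj; rewrite /E /=; case: eqP => // kE; lia. Qed.

Lemma E_diag j : (0 < j)%N -> E p j j = 1.
Proof. by case: j => // j _; rewrite /E eqxx. Qed.

Lemma ps_mul_low n g h r : inU n h -> (r < n)%N -> ps_mul g h r = g r.
Proof.
move=> [h0 hn] rn; rewrite /ps_mul big_ord_recr /= subnn h0 mulr1 big1 ?add0r //.
by move=> [i ir] _ /=; rewrite hn ?mulr0 //; lia.
Qed.

Lemma ps_mul_top n g h : (0 < n)%N -> inU n h -> ps_mul g h n = g n + g 0%N * h n.
Proof.
case: n => // n _ [h0 hn]; rewrite /ps_mul big_ord_recr /= subnn h0 mulr1.
rewrite big_ord_recl /= subn0 big1 ?addr0 1?addrC // => -[i ir] _ /=.
by rewrite /bump /= hn ?mulr0 //; lia.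
Qed.

Lemma inU_mul n g h : inU n g -> inU n h -> inU n (ps_mul g h).
Proof.
move=> [g0 gn] hU; split.
  by rewrite /ps_mul big_ord1 g0 mul1r; case: hU.
by move=> k kn; rewrite (ps_mul_low _ hU) ?gn //; lia.
Qed.

Lemma inU_pow n g j : inU n g -> inU n (ps_pow g j).
Proof.
by move=> gU; elim: j => [|j IH]; [exact: inU_one | exact: inU_mul].
Qed.

(** Multiplication on U_n modulo U_(n+1) is addition of the coefficients of t^n. *)
Lemma ps_pow_top n g j : (0 < n)%N -> inU n g -> ps_pow g j n = g n *+ j.
Proof.
move=> n0 gU; elim: j => [|j IH]; first by case: n n0 gU.
rewrite /ps_pow iterS -/(ps_pow g j) (ps_mul_top _ n0 (inU_pow j gU)) IH mulrS.
by case: gU => -> _; rewrite mul1r.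
Qed.

(** * Effect of a substitution on the filtration and on the E_j *)

Lemma inU_comp j f u : inU j f -> inU j (ps_comp f u).
Proof.
move=> [f0 fj]; split=> [|k kj]; first by rewrite ps_comp0.
rewrite /ps_comp big1 // => -[[|i] ik] _ /=; last by rewrite fj ?mul0r //; lia.
by rewrite /ps_pow /= /ps_one; case: eqP => [|_]; [lia | rewrite mulr0].
Qed.

Lemma comp_agree n f g u : (forall k, (k < n)%N -> f k = g k) ->
  forall k, (k < n)%N -> ps_comp f u k = ps_comp g u k.
Proof.
by move=> fg k kn; apply: eq_bigr => i _; rewrite fg //; have := ltn_ord i; lia.
Qed.

(** Here u = t v equals t modulo t^(k+1), so f(u) agrees with f up to and including t^k. *)
Lemma comp_mult_low k f v n : inU k v -> (n <= k)%N ->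
  ps_comp f (ps_mult v) n = f n.
Proof.
move=> vU nk; rewrite /ps_comp big_ord_recr /= big1 => [|[i ir] _ /=]; last first.
  rewrite ps_pow_mult; case: ifP => [|_]; first by lia.
  case: i ir => [|i] ir.
    by rewrite /ps_pow /= /ps_one; case: eqP => [|_]; [lia | rewrite mulr0].
  by have [_ ->] := inU_pow i.+1 vU; rewrite ?mulr0 //; lia.
rewrite ps_pow_mult ltnn subnn add0r.
by have [-> _] := inU_pow n vU; rewrite mulr1.
Qed.

Lemma comp_E j u n : (0 < j)%N -> u 0%N = 0 ->
  ps_comp (E p j) u n = (n == 0%N)%:R + ps_pow u j n.
Proof.
move=> j0 u0.
have aE : approx n.+1 (E p j) (1 + 'X^j).
  move=> k _; rewrite coefD coef1 coefXn /E.
  by case: eqP => [->|_]; [case: eqP; [lia | rewrite addr0] | case: eqP; rewrite add0r].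
have au := @approx_poly n.+1 u.
rewrite (approx_comp u0 aE au) // comp_polyD comp_Xn_poly coefD.
by rewrite (approx_pow j au) // -[1]/(1%:P) comp_polyC coef1.
Qed.

(** E_j(u) = 1 + t^j v^j with v^j in U_k, so E_j is fixed j-1 orders further than a general
    series. *)
Lemma comp_E_low k v j n : (0 < j)%N -> inU k v -> (n < j + k)%N ->
  ps_comp (E p j) (ps_mult v) n = E p j n.
Proof.
move=> j0 vU nk; rewrite comp_E // ps_pow_mult /E.
case: eqP => [->|n0] /=; first by rewrite j0 addr0.
case: ltnP => nj; first by case: eqP => [|_]; [lia | rewrite addr0].
have [v0 vk] := inU_pow j vU; case: eqP => [->|nej]; first by rewrite subnn v0 add0r.
by rewrite vk ?addr0 //; lia.
Qed.

(** The factor j comes from the leading term of v^j - 1; it is invertible in F_p when p does not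
    divide j. *)
Lemma comp_E_top k v j : (0 < j)%N -> (0 < k)%N -> inU k v ->
  ps_comp (E p j) (ps_mult v) (j + k) = v k *+ j.
Proof.
move=> j0 k0 vU; rewrite comp_E // ps_pow_mult ltnNge leq_addr /= addKn.
by rewrite (ps_pow_top _ k0 vU); case: eqP => [|_]; [lia | rewrite add0r].
Qed.

Definition onep (c : 'F_p) (k : nat) : ps p :=
  fun n => if n == 0%N then 1 else if n == k then c else 0.

Lemma inU_onep c k : inU k (onep c k).
Proof. by split=> // -[|i] // kj; rewrite /onep /=; case: eqP => // kE; lia. Qed.

Lemma onep_diag c k : (0 < k)%N -> onep c k k = c.
Proof. by case: k => // k _; rewrite /onep eqxx. Qed.

Hypothesis hp : prime p.

(** Frobenius: (1 + t G)^(p^e) = 1 + t^(p^e) G^(p^e). *)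
Lemma inU_pow_pchar g e : inU1 g -> inU (p ^ e) (ps_pow g (p ^ e)).
Proof.
move=> gU; split; first by case: (inU_pow (p ^ e) gU).
move=> k /andP[k0 ke].
have a : approx k.+1 g (1 + 'X * \poly_(i < k.+1) g i.+1).
  move=> [|i] ik; rewrite coefD coef1 coefXM /= ?addr0; first by case: gU.
  by rewrite add0r coef_poly; case: ltnP => //; lia.
have chp : p \in [pchar {poly 'F_p}] by rewrite pchar_poly pchar_Fp.
rewrite (approx_pow _ a) // exprDn_pchar; last first.
  by rewrite pnatX pnatE // chp.
rewrite expr1n exprMn coefD coef1 coefXnM ke addr0.
by case: eqP k0 => // ->.
Qed.

End PowerSeries.

(** * Multiples of p and generators in Z/p^2 *)

Section ModPSquare.
Variables (p : nat) (hp : prime p).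
Implicit Types z w : 'Z_(p ^ 2).

Lemma p2_gt1 : (1 < p ^ 2)%N.
Proof. by have := prime_gt1 hp; rewrite -mulnn; nia. Qed.

Lemma natr_p2_eq0 n : ((n%:R : 'Z_(p ^ 2)) == 0) = (p ^ 2 %| n)%N.
Proof. by rewrite -val_eqE /= val_Zp_nat ?p2_gt1. Qed.

Lemma mulrn_p2 z : z *+ (p ^ 2) = 0.
Proof. by rewrite -mulr_natr (eqP (_ : (p ^ 2)%:R == 0)) ?mulr0 // natr_p2_eq0. Qed.

(** Membership in pZ/p^2 becomes the vanishing of a multiple, so chi modulo p can be handled as the
    character p chi. *)
Lemma mulrn_p_eq0 z : (z *+ p == 0) = (p %| (z : nat))%N.
Proof.
rewrite -[z in LHS]natr_Zp -mulrnA natr_p2_eq0.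
by move: (nat_of_ord z) => n; rewrite -mulnn mulnC dvdn_pmul2l ?prime_gt0.
Qed.

Lemma generates_all z w : z *+ p != 0 -> exists d, z *+ d = w.
Proof.
rewrite mulrn_p_eq0 -prime_coprime // => zp.
have zU : z \is a GRing.unit by rewrite -[z]natr_Zp unitZpE ?p2_gt1 // coprimeXl.
by exists (z^-1 * w); rewrite -mulr_natr natr_Zp mulrA divrr // mul1r.
Qed.

Lemma generates_p z w : z != 0 -> z *+ p = 0 -> w *+ p = 0 -> exists d, z *+ d = w.
Proof.
move=> z0 /eqP + /eqP; rewrite !mulrn_p_eq0 => /dvdnP[a za] /dvdnP[b wb].
(* Both elements are multiples of p; cancelling p leaves [a] prime to p, hence a unit. *)
have [|d ad] := @generates_all a%:R b%:R.
  apply: contraNneq z0 => az; rewrite -[z]natr_Zp za -az -mulrnA; exact/eqP.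
exists d; rewrite -[z]natr_Zp za -[w]natr_Zp wb !mulrnA -ad; exact: mulrnAC.
Qed.

End ModPSquare.

(** * Characters and their values near 1 *)

Section Characters.
Variables (p : nat) (hp : prime p).
Implicit Types (f g h u v : ps p) (chi psi theta : ps p -> 'Z_(p ^ 2)).

(** Pointwise equal sequences are not identified as functions; continuity makes [chi] respect
    [=1]. *)
Lemma char_ext chi f g : is_character chi -> inU1 f -> f =1 g -> chi f = chi g.
Proof.
move=> [_ cont] fU fg; have [n /(_ g) <- //] := cont f fU.
by case: fU => f0 _; split=> [|k]; [rewrite -fg | lia].
Qed.

Lemma char_one chi : is_character chi -> chi (ps_one p) = 0.
Proof.
move=> ch; have U1 := @inU_one p 1; apply: (@addrI _ (chi (ps_one p))).
rewrite addr0 -(proj1 ch) //; symmetry; apply: char_ext => // k.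
by rewrite (ps_mul_low _ (inU_one p k.+1)).
Qed.

Lemma char_pow chi g j : is_character chi -> inU1 g -> chi (ps_pow g j) = chi g *+ j.
Proof.
move=> ch gU; elim: j => [|j IH]; first exact: char_one.
by rewrite /ps_pow iterS (proj1 ch) // ?IH ?mulrS //; apply: inU_pow.
Qed.

Lemma char_mulrn chi s : is_character chi -> is_character (fun f => chi f *+ s).
Proof.
move=> [mul cont]; split=> [f g fU gU|f fU]; first by rewrite mul // mulrnDl.
by have [n nP] := cont f fU; exists n => g gU /nP->.
Qed.

(* [g ^ (p ^ e)] is close to 1, so [g ^ (p ^ e - 1)] serves as an inverse of [g]. *)
Lemma char_agree chi n f g : is_character chi -> (forall h, inU n h -> chi h = 0) ->
  inU1 f -> inU1 g -> (forall k, (k < n)%N -> f k = g k) -> chi f = chi g.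
Proof.
(* The exponent e = n+2 serves twice: p^e > n puts g^(p^e) in U_n, and p^2 divides p^e, so chi
   vanishes on g^(p^e). *)
move=> ch ch0 fU gU fg; pose e := n.+2.
have pe : (n < p ^ e)%N by apply: ltn_trans (ltn_expl _ (prime_gt1 hp)).
have gpow := inU_pow_pchar hp e gU.
have pge : chi g *+ (p ^ e) = 0.
  have -> : (p ^ e = p ^ 2 * p ^ n)%N by rewrite -expnD.
  by rewrite mulrnA mulrn_p2 // mul0rn.
have e1 : (p ^ e).-1.+1 = (p ^ e)%N by rewrite prednK //; lia.
apply: (@addIr _ (chi g *+ (p ^ e).-1)); rewrite -mulrS e1 pge.
rewrite -char_pow // -(proj1 ch) //; last exact: inU_pow.
apply: ch0; have [g0 gk] := inU_le (ltnW pe) gpow.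
have E1 k : (k < n)%N -> ps_mul f (ps_pow g (p ^ e).-1) k = ps_pow g (p ^ e) k.
  move=> kn; rewrite -[in RHS]e1 /ps_pow iterS; apply: eq_bigr => i _.
  by rewrite fg //; have := ltn_ord i; lia.
split; first by have [] : inU1 (ps_mul f (ps_pow g (p ^ e).-1))
  by apply: inU_mul => //; apply: inU_pow.
by move=> k kn; rewrite E1 ?gk //; lia.
Qed.

(** f and g E_n^d agree modulo t^(n+1). *)
Lemma char_top chi n d f g : is_character chi ->
  (forall h, inU n.+1 h -> chi h = 0) -> (0 < n)%N -> inU1 f -> inU1 g ->
  (forall k, (k < n)%N -> f k = g k) -> f n = g n + d%:R ->
  chi f = chi g + chi (E p n) *+ d.
Proof.
move=> ch ch0 n0 fU gU fg fn; have EU := inU_pow d (inU_E p n).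
have E1 := inU_1 (inU_E p n).
rewrite -char_pow // -(proj1 ch) //; last exact: inU_1 EU.
apply: (char_agree ch ch0) => //; first by apply: inU_mul => //; apply: inU_1 EU.
move=> k; rewrite ltnS leq_eqVlt => /orP[/eqP->|kn]; last first.
  by rewrite (ps_mul_low _ EU) // fg.
rewrite (ps_mul_top _ n0 EU) (ps_pow_top _ n0 (inU_E p n)) E_diag // fn.
by case: gU => -> _; rewrite mul1r.
Qed.

(** E_n generates U_n modulo U_(n+1), so a character that kills E_n and U_(n+1) kills U_n. *)
Lemma char_E_neq0 chi n f : is_character chi ->
  (forall h, inU n.+1 h -> chi h = 0) -> (0 < n)%N -> inU n f -> chi f != 0 ->
  chi (E p n) != 0.
Proof.
move=> ch ch0 n0 fU; apply: contraNneq => E0.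
have f_low k : (k < n)%N -> f k = ps_one p k.
  by case: k => [|k] kn; case: fU => // _ ->.
have f_top : f n = ps_one p n + (f n : nat)%:R.
  by rewrite natr_Zp /ps_one; case: eqP n0 => [->|]; rewrite ?add0r.
rewrite (char_top ch ch0 n0 (inU_1 fU) (@inU_one p 1) f_low f_top).
by rewrite E0 mul0rn addr0 char_one.
Qed.

Lemma char_comp chi u : is_character chi -> u 0%N = 0 ->
  is_character (fun f => chi (ps_comp f u)).
Proof.
move=> ch u0; split=> [f g fU gU|f fU].
  rewrite -(proj1 ch); try exact: inU_comp.
  by apply: char_ext (comp_psM f g u0); last by apply/inU_comp/inU_mul.
have [n nP] := proj2 ch _ (inU_comp u fU); exists n => g gU gf.
by apply: nP; [exact: inU_comp | exact: comp_agree].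
Qed.

(** * Strict equivalence and the single reduction step *)

Lemma strictly_equiv_refl chi : is_character chi -> strictly_equiv chi chi.
Proof.
move=> ch; exists (ps_mult (ps_one p)); split=> //; split=> [f fU|].
  apply: char_ext => // k.
  by rewrite (comp_mult_low _ (inU_one p k)).
exact: char_one.
Qed.

(** If psi(f) = chi(f(v)) and u = t w, the combined substitution is u(v), and the cocycle rule gives
    chi(u(v)/t) = psi(w) + chi(v/t) = 0. *)
Lemma strictly_equiv_comp chi psi w : is_character chi ->
  strictly_equiv chi psi -> inU1 w -> psi w = 0 ->
  strictly_equiv chi (fun f => psi (ps_comp f (ps_mult w))).
Proof.
move=> ch [v [[v0 v1] [psiE chv]]] uU psu; pose u := ps_mult w.
have u0 : u 0%N = 0 by [].
have vU : inU1 (ps_divt v) by split=> // k; lia.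
have dU : inU1 (ps_mul (ps_comp (ps_divt u) v) (ps_divt v)).
  by apply: inU_mul => //; apply: inU_comp.
have E1 := divt_comp v0 u0.
exists (ps_comp u v); split; last split.
- by split; rewrite ?ps_comp0 // -[LHS]/(ps_divt (ps_comp u v) 0%N) E1; case: dU.
- move=> f fU; rewrite psiE; last exact: inU_comp.
  apply: char_ext => //; last exact: comp_psA.
  by do 2! apply: inU_comp.
- rewrite -(@char_ext chi _ _ ch dU); last by move=> k; rewrite E1.
  by rewrite (proj1 ch) ?chv ?addr0 -?psiE //; apply: inU_comp.
Qed.

(** The multiplier [s] treats both stages at once: s = p with n = l, and s = 1 with n = m. The last
    hypothesis supplies the correction that makes chi(u/t) vanish. *)
Lemma reduction_step chi n s i d : is_character chi ->
  (forall h, inU n.+1 h -> chi h *+ s = 0) -> (0 < i < n)%N -> ~~ (p %| i)%N ->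
  (forall c, exists2 g, inU n g & chi g = - chi (onep c (n - i))) ->
  exists v, [/\ inU (n - i) v, chi v = 0,
    forall j, (i < j)%N -> chi (ps_comp (E p j) (ps_mult v)) *+ s = chi (E p j) *+ s
  & chi (ps_comp (E p i) (ps_mult v)) *+ s = chi (E p i) *+ s + chi (E p n) *+ s *+ d].
Proof.
(* Division by i cancels the factor i by which the substitution multiplies c in E_i. *)
move=> ch ch0 /andP[i0 i_n] pi corr; pose c : 'F_p := d%:R / i%:R.
have i_neq0 : (i%:R : 'F_p) != 0 by rewrite -(dvdn_pcharf (pchar_Fp hp)).
have [g gU gE] := corr c; set k := (n - i)%N in gE *.
have k0 : (0 < k)%N by rewrite /k; lia.
have oU := inU_onep c k.
(* Since n - i < n, the factor g in U_n leaves the leading coefficient c of v - 1 intact. *)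
pose v := ps_mul (onep c k) g.
have vU : inU k v by apply: inU_mul => //; apply: inU_le gU; rewrite /k; lia.
have vk : v k = c by rewrite /v (ps_mul_low _ gU) ?onep_diag // /k; lia.
have ch' := char_mulrn s ch.
have nik : n = (i + k)%N by rewrite /k; lia.
exists v; split=> //.
- rewrite (proj1 ch) ?gE ?subrr //; [exact: inU_1 oU|exact: inU_1 gU].
- move=> j ij; have EU := inU_1 (inU_E p j).
  apply: (char_agree ch' ch0) => //; first exact: inU_comp.
  by move=> r rn; rewrite (comp_E_low _ vU) //; lia.
- have EU := inU_1 (inU_E p i).
  apply: (@char_top _ n d _ _ ch' ch0) => //; first by lia.
  + exact: inU_comp.
  + by move=> r rn; rewrite (comp_E_low _ vU) //; lia.
  + rewrite [in LHS]nik comp_E_top // vk /E; case: eqP => [|_]; first by lia.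
    case: eqP => [|_]; first by lia.
    by rewrite add0r -[LHS]mulr_natr /c mulfVK.
Qed.

(** * Characters of type <l, m> and the two stages of reduction *)

Definition typed l m chi :=
  [/\ is_character chi, forall h, inU m.+1 h -> chi h = 0,
      forall h, inU l.+1 h -> chi h *+ p = 0, chi (E p m) != 0
    & chi (E p l) *+ p != 0].

(** Maximality of a break b gives vanishing on U_(b+1); nonvanishing on U_b then passes to E_b. *)
Lemma has_type_typed l m chi : is_character chi -> has_type chi l m -> typed l m chi.
Proof.
move=> ch [l0 [[f [fU fl]] [lmax [m0 [[g [gU gm]] mmax]]]]].
have ch0 h : inU m.+1 h -> chi h = 0.
  move=> hU; apply/eqP/negP => /negP h0.
  by have := mmax m.+1 isT (ex_intro _ h (conj hU h0)); rewrite ltnn.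
have chp h : inU l.+1 h -> chi h *+ p = 0.
  move=> hU; apply/eqP; rewrite mulrn_p_eq0 //; apply/negP => /negP h0.
  by have := lmax l.+1 isT (ex_intro _ h (conj hU h0)); rewrite ltnn.
split=> //; first exact: char_E_neq0 gU gm.
by apply: (char_E_neq0 (char_mulrn p ch) chp l0 fU); rewrite mulrn_p_eq0.
Qed.

(* [E_l ^ p] lies in [U_(l+1)], while [chi] does not vanish on it. *)
Lemma typed_lt l m chi : (0 < l)%N -> typed l m chi -> (l < m)%N.
Proof.
move=> l0 [ch ch0 chp Em El]; rewrite ltnNge; apply: contra El => ml.
have EU := inU_E p l; rewrite -char_pow //; last exact: inU_1 EU.
rewrite ch0 //; have [P0 Pk] := inU_pow p EU; split=> // k kl.
have [->|kl'] := eqVneq k l; last by apply: Pk; lia.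
by rewrite ps_pow_top // E_diag //; apply/eqP; rewrite -(dvdn_pcharf (pchar_Fp hp)).
Qed.

(** A substitution preserves every U_j and fixes E_n modulo t^(n+1). *)
Lemma typed_comp l m chi v : (0 < l)%N -> (0 < m)%N -> typed l m chi -> inU1 v ->
  typed l m (fun f => chi (ps_comp f (ps_mult v))).
Proof.
move=> l0 m0 [ch ch0 chp Em El] vU.
have top theta n : is_character theta -> (forall h, inU n.+1 h -> theta h = 0) ->
    (0 < n)%N -> theta (ps_comp (E p n) (ps_mult v)) = theta (E p n).
  move=> th th0 n0; have EU := inU_1 (inU_E p n).
  apply: (char_agree th th0) => //; first exact: inU_comp.
  by move=> k kn; rewrite (comp_E_low n0 vU) //; lia.
split.
- exact: char_comp.
- by move=> h hU; rewrite ch0 //; apply: inU_comp.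
- by move=> h hU; rewrite chp //; apply: inU_comp.
- by rewrite top.
- by rewrite (top (fun f => chi f *+ p)) //; apply: char_mulrn.
Qed.

(** Downward induction from l-1: the step at i leaves p psi(E_j) unchanged for j > i, so cleared
    indices stay cleared. *)
Lemma clear_below_l l m chi r : (0 < l)%N -> typed l m chi ->
  exists psi, [/\ typed l m psi, strictly_equiv chi psi &
    forall j, (0 < j < l)%N -> (l - r <= j)%N -> ~~ (p %| j)%N -> psi (E p j) *+ p = 0].
Proof.
move=> l0 chT; have lm := typed_lt l0 chT; have ch : is_character chi by case: chT.
elim: r => [|r [psi [psT eqv psE]]].
  by exists chi; split=> //; [exact: strictly_equiv_refl | move=> j; lia].
(* Truncated subtraction gives i = 0 once l is exhausted; then, or if p divides i, there is nothing
   to do. *)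
pose i := (l - r.+1)%N; have [/andP[i0 pi]|ni] := boolP ((0 < i)%N && ~~ (p %| i)%N); last first.
  exists psi; split=> // j j0 jr pj; apply: psE => //.
  have ji : j != i by apply: contraNneq ni => <-; rewrite pj; case/andP: j0 => ->.
  by rewrite /i in ji; lia.
have [ps ps0 psp Em El] := psT.
have mulpp z : (z : 'Z_(p ^ 2)) *+ p *+ p = 0 by rewrite -mulrnA mulnn mulrn_p2.
have [d dE] : exists d, psi (E p l) *+ p *+ d = - (psi (E p i) *+ p).
  by apply: generates_p; rewrite // mulNrn mulpp oppr0.
(* psi(E_l) is a unit, so some power of E_l takes any prescribed value. *)
have corr c : exists2 g, inU l g & psi g = - psi (onep c (l - i)).
  have [e eE] := generates_all hp (- psi (onep c (l - i))) El.
  exists (ps_pow (E p l) e); first by apply/inU_pow/inU_E.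
  by rewrite char_pow //; apply: inU_1 (inU_E p l).
have il : (0 < i < l)%N by rewrite /i in i0 *; lia.
have [v [vU v0 vj vi]] := reduction_step d ps psp il pi corr.
exists (fun f => psi (ps_comp f (ps_mult v))); split.
- by apply: typed_comp => //; [lia | exact: inU_1 vU].
- by apply: strictly_equiv_comp => //; apply: inU_1 vU.
- move=> j jl jr pj; have [->|ji] := eqVneq j i; first by rewrite vi dE subrr.
  by rewrite vj ?psE //; rewrite /i in ji *; lia.
Qed.

(** Again downward, now from m-l-1. The values are already right modulo p, and psi(E_m) generates
    pZ/p^2, so the remaining error can be removed. *)
Lemma clear_below_mBl l m chi0 chi (x : nat) r : (0 < l)%N ->
  is_character chi0 -> typed l m chi -> strictly_equiv chi0 chi ->
  (forall j, (0 < j)%N -> ~~ (p %| j)%N ->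
     chi (E p j) *+ p = (x * (j == l))%:R *+ p) ->
  exists psi, [/\ typed l m psi, strictly_equiv chi0 psi,
    forall j, (0 < j)%N -> ~~ (p %| j)%N -> psi (E p j) *+ p = (x * (j == l))%:R *+ p &
    forall j, (0 < j < m - l)%N -> (m - l - r <= j)%N -> ~~ (p %| j)%N ->
      psi (E p j) = (x * (j == l))%:R].
Proof.
move=> l0 ch chT eqv0 chx; have lm := typed_lt l0 chT.
elim: r => [|r [psi [psT eqv psx psE]]].
  by exists chi; split=> // j; lia.
pose i := (m - l - r.+1)%N.
have [/andP[i0 pi]|ni] := boolP ((0 < i)%N && ~~ (p %| i)%N); last first.
  exists psi; split=> // j j0 jr pj; apply: psE => //.
  have ji : j != i by apply: contraNneq ni => <-; rewrite pj; case/andP: j0 => ->.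
  by rewrite /i in ji; lia.
have [ps ps0 psp Em El] := psT.
have Emp : psi (E p m) *+ p = 0 by apply: psp; apply: inU_le (inU_E p m); lia.
(* The target is x rather than 0 at i = l, an index that may lie below m - l. *)
have [d dE] : exists d, psi (E p m) *+ d = (x * (i == l))%:R - psi (E p i).
  by apply: generates_p => //; rewrite mulrnBl psx // subrr.
(* As m - i > l, the series 1 + c t^(m-i) lies in U_(l+1); its value is thus in pZ/p^2 and a power
   of E_m cancels it. *)
have corr c : exists2 g, inU m g & psi g = - psi (onep c (m - i)).
  have [|e eE] := generates_p hp (w := - psi (onep c (m - i))) Em Emp.
    by rewrite mulNrn psp ?oppr0 //; apply: inU_le (inU_onep c _); rewrite /i; lia.
  exists (ps_pow (E p m) e); first by apply/inU_pow/inU_E.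
  by rewrite char_pow //; apply: inU_1 (inU_E p m).
have im : (0 < i < m)%N by rewrite /i in i0 *; lia.
have [v [vU v0 vj vi]] := reduction_step (s := 1) d ps ps0 im pi corr.
exists (fun f => psi (ps_comp f (ps_mult v))); split.
- by apply: typed_comp => //; [lia | exact: inU_1 vU].
- by apply: strictly_equiv_comp => //; apply: inU_1 vU.
- move=> j j0 pj; rewrite -psx //.
  (* The substitution fixes every series modulo t^(l+1), because m - i > l, so values modulo p do
     not change. *)
  have EU := inU_1 (inU_E p j).
  apply: (char_agree (char_mulrn p ps) psp) => //; first exact: inU_comp.
  by move=> k kl; rewrite (comp_mult_low _ vU) // /i; lia.
- move=> j jl jr pj; have [->|ji] := eqVneq j i; first by rewrite [LHS]vi dE addrC subrK.
  by rewrite [LHS]vj ?mulr1n ?psE //; rewrite /i in ji *; lia.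
Qed.

(** After subtraction of the x-term the value at E_j is a multiple of p; b_j is the quotient by p of
    its representative below p^2. *)
Lemma typed_reduced l m psi (x : nat) : (0 < l)%N -> typed l m psi -> (0 < x < p)%N ->
  (forall j, (0 < j)%N -> ~~ (p %| j)%N -> psi (E p j) *+ p = (x * (j == l))%:R *+ p) ->
  (forall j, (0 < j < m - l)%N -> ~~ (p %| j)%N -> psi (E p j) = (x * (j == l))%:R) ->
  reduced_form l m psi.
Proof.
move=> l0 psT x0 psx psE; have lm := typed_lt l0 psT.
have [ps ps0 psp Em El] := psT.
pose y j : 'Z_(p ^ 2) := psi (E p j) - (x * (j == l))%:R.
have yE j : (0 < j)%N -> ~~ (p %| j)%N -> (y j : nat) = (p * (y j %/ p))%N.
  move=> j0 pj; rewrite mulnC divnK // -mulrn_p_eq0 //.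
  by rewrite mulrnBl psx // subrr.
have m0 : (0 < m)%N by lia.
exists x, (fun j => (y j %/ p)%N); split=> //; split.
  move=> j; rewrite ltn_divLR ?prime_gt0 //.
  by have := ltn_ord (y j); rewrite [X in (_ < X)%N -> _]Zp_cast ?p2_gt1.
split=> [pm|i i0 pi].
  (* Since m > l, the x-term is absent at m, and b_m = 0 would force psi(E_m) = 0. *)
  apply: contra Em => /eqP ym0; have := yE m m0 pm; rewrite ym0 muln0 => ym.
  have ym' : y m = 0 by apply/val_inj.
  by move: ym'; rewrite /y [m == l]gtn_eqF // muln0 subr0 => ->.
(* Below m - l the value is already normalised; above m both sides vanish, as i > m > l. *)
case: (leqP (m - l) i) => /= mi; last by rewrite muln0 addn0 psE //; lia.
case: (leqP i m) => im; last first.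
  rewrite muln0 addn0 ps0; first by rewrite gtn_eqF ?muln0 //; lia.
  by apply: inU_le (inU_E p i).
by rewrite muln1 natrD -yE // natr_Zp addrC subrK.
Qed.

End Characters.

Theorem theorem1p1 (p : nat) (hp : prime p) (chi : ps p -> 'Z_(p ^ 2)) (l m : nat) :
  is_character chi -> surjective_char chi -> has_type chi l m ->
  exists psi : ps p -> 'Z_(p ^ 2),
    is_character psi /\ strictly_equiv chi psi /\ reduced_form l m psi.
Proof.
move=> ch _ chT; have l0 : (0 < l)%N by case: chT.
(* Taking r = l makes l - r = 0, so every index below l is covered. *)
have [chi1 [chT1 eqv1 chE1]] := clear_below_l hp l l0 (has_type_typed hp ch chT).
have [_ _ chp1 _ El1] := chT1.
(* The multiple of p in chi1(E_l) is removed by the second stage if l < m - l, and otherwise goes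
   into b_l. *)
pose x := (chi1 (E p l) %% p)%N.
have x_bounds : (0 < x < p)%N.
  rewrite ltn_mod [X in _ && X](prime_gt0 hp) andbT lt0n.
  by move: El1; rewrite mulrn_p_eq0.
have chx j : (0 < j)%N -> ~~ (p %| j)%N ->
    chi1 (E p j) *+ p = (x * (j == l))%:R *+ p.
  move=> j0 pj; case: (ltngtP j l) => [jl|lj|->].
  - by rewrite muln0 mul0rn chE1 //; lia.
  - by rewrite muln0 mul0rn chp1 //; apply: inU_le (inU_E p j).
  - rewrite muln1 -[in LHS](natr_Zp (chi1 _)) [in LHS](divn_eq (chi1 (E p l)) p).
    rewrite natrD mulrnDl -[X in X + _]mulrnA -mulnA mulnn.
    by rewrite mulrnA mulrn_p2 // add0r.
have [psi [psT eqv psx psE]] := clear_below_mBl hp m l0 ch chT1 eqv1 chx.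
exists psi; split; first by case: psT.
split=> //; apply: (typed_reduced hp l0 psT x_bounds psx) => j jl pj.
by apply: psE => //; lia.
Qed.
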